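(* Let $n\in\mathbb{N}$, $n\geq 2$. There is a computable abelian group $(G,+,0)$ and an element $b\in G$, $b\neq 0$, such that, if $c$ is a $2n$-coloring of $G$ for which the equation $$(x_1-y_1)+\dots+(x_n-y_n)=b$$ has no pairwise monochromatic solutions and there is an integer $m>0$ such that all the elements $kmb$, $k\in\mathbb{Z}$, are colored by $c$ with the same color, then $c$ has PA degree.
   Context: A computable group is a group whose underlying set and group operations are computable. For $k>1$, a $k$-coloring of $G$ is any map $c:G\to k=\{0,\dots,k-1\}$. A tuple $(x_1,y_1,\dots,x_n,y_n)\in G^{2n}$ is pairwise monochromatic for $c$ if $c(x_i)=c(y_i)$ for all $i=1,\dots,n$; a pairwise monochromatic solution of an equation is a solution that is pairwise monochromatic for $c$. A tree is a set of finite strings closed under initial segments; a binary tree is a tree contained in $2^{<\mathbb{N}}$. A set (or function) $X$ has PA degree if every computable infinite binary tree has an $X$-computable infinite path. *)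

(* Defs.v *)
From HB Require Import structures.
From Stdlib Require Cantor.
From mathcomp Require Import all_boot all_order all_algebra.
From mathcomp Require Import classical_sets cardinality.

Set Implicit Arguments.
Unset Strict Implicit.
Unset Printing Implicit Defensive.

Import Order.TTheory GRing.Theory Num.Theory.

Local Open Scope ring_scope.

Notation "<| x , y |>" := (Cantor.to_nat (x, y)) (at level 0, x at level 99,
  y at level 99, format "<| x ,  y |>") : nat_scope.

(* Programs for the partial recursive functions of one argument, relative to
   an oracle; functions of several arguments go through Cantor's pairing. *)
Inductive prog : Type :=
  | Zero | Succ | Fst | Snd | Oracle
  | Pair of prog & prog
  | Comp of prog & prog
  | Prec of prog & prog
  | Mu of prog.

(* [eval g e a v]: program [e], run on input [a] with oracle [g], halts with
   output [v].  In the [Mu] rule, [w] collects the (nonzero) values found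
   before the first zero, which must all be defined. *)
Inductive eval (g : nat -> nat) : prog -> nat -> nat -> Prop :=
  | eval_Zero a : eval g Zero a 0%N
  | eval_Succ a : eval g Succ a a.+1
  | eval_Fst a b : eval g Fst <|a, b|>%N a
  | eval_Snd a b : eval g Snd <|a, b|>%N b
  | eval_Oracle a : eval g Oracle a (g a)
  | eval_Pair e1 e2 a v1 v2 :
      eval g e1 a v1 -> eval g e2 a v2 -> eval g (Pair e1 e2) a <|v1, v2|>%N
  | eval_Comp e1 e2 a u v :
      eval g e2 a u -> eval g e1 u v -> eval g (Comp e1 e2) a v
  | eval_Prec0 e1 e2 a v :
      eval g e1 a v -> eval g (Prec e1 e2) <|a, 0|>%N v
  | eval_PrecS e1 e2 a i u v :
      eval g (Prec e1 e2) <|a, i|>%N u -> eval g e2 <|a, <|i, u|>|>%N v ->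
      eval g (Prec e1 e2) <|a, i.+1|>%N v
  | eval_Mu e a i (w : nat -> nat) :
      (forall j, (j < i)%N -> eval g e <|a, j|>%N (w j).+1) ->
      eval g e <|a, i|>%N 0%N ->
      eval g (Mu e) a i.

Definition computable_in (g f : nat -> nat) : Prop :=
  exists e, forall a, eval g e a (f a).

(* A constant oracle provides no information. *)
Definition computable (f : nat -> nat) : Prop := computable_in (fun=> 0%N) f.

Definition computable_set (A : set nat) : Prop :=
  exists2 chi : pred nat,
    computable (fun a => nat_of_bool (chi a)) & forall a, A a <-> chi a.

(* The bijection between finite binary strings and natural numbers given by
   () |-> 0, s0 |-> 2 * s + 1, s1 |-> 2 * s + 2. *)
Definition string_code (s : seq bool) : nat :=
  foldl (fun r (b : bool) => (r.*2 + b).+1) 0%N s.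

Definition binary_tree (T : set (seq bool)) : Prop :=
  forall s t, prefix s t -> T t -> T s.

Definition computable_tree (T : set (seq bool)) : Prop :=
  binary_tree T /\ computable_set (string_code @` T)%classic.

Definition infinite_path (T : set (seq bool)) (p : nat -> bool) : Prop :=
  forall i, T (mkseq p i).

Definition PA_degree (g : nat -> nat) : Prop :=
  forall T, computable_tree T -> infinite_set T ->
    exists2 p, infinite_path T p & computable_in g (fun i => nat_of_bool (p i)).

(* Abelian groups whose underlying set is a set of natural numbers. *)
Record natGroup := NatGroup {
  nat_domain : pred nat;
  nat_group_class : GRing.Zmodule {a : nat | nat_domain a}
}.

Definition nat_group_sort (G : natGroup) : zmodType :=
  GRing.Zmodule.Pack (nat_group_class G).
Coercion nat_group_sort : natGroup >-> GRing.Zmodule.type.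

Definition nat_of_elt (G : natGroup) (x : G) : nat :=
  val (x : {a : nat | nat_domain G a}).

Definition computable_group (G : natGroup) : Prop :=
  [/\ computable_set [set a | nat_domain G a]%classic,
      exists2 add, computable add &
        forall x y : G,
          nat_of_elt (x + y) = add <|nat_of_elt x, nat_of_elt y|>%N &
      exists2 opp, computable opp &
        forall x : G, nat_of_elt (- x) = opp (nat_of_elt x)].

Definition pairwise_monochromatic (G C : Type) (c : G -> C) (n : nat)
    (x y : 'I_n -> G) : Prop :=
  forall i, c (x i) = c (y i).

(* A coloring as an oracle: it is extended by 0 outside the computable set of
   group elements. *)
Definition coloring_oracle (G : natGroup) (k : nat) (c : G -> 'I_k)
    (a : nat) : nat :=
  if insub a is Some x then c (x : {a : nat | nat_domain G a}) else 0%N.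

(* Main.v *)
(* The group is generated by [b] and elements [g_q], one for each initial state [q]
   of a universal machine.  If [q] halts after [t] steps, then [g_q = (T! + v) b],
   where [T = <q, t>] and [v = 1] if the output is 1, [v = 0] otherwise; the [g_q]
   with [q] running forever are independent.  Pretending that a computation still
   running at stage [B] halts there (with [v = 0]) turns each [g_q] into a sequence
   of integers indexed by [B], and the relations above are those that hold between
   these sequences for all large [B].  They are decidable: as [T! / (T-1)!] is
   unbounded, a relation that holds at one stage beyond a bound given by its
   coefficients holds at every stage beyond it.

   Let [c] be a coloring as in the theorem.  If [q] is padded so that [T >= m],
   then [m] divides [T!], so [c (g_q) = c 0] when [q] halts with value 0.  When it
   halts with value 1, [g_q = (1 + m k) b] and [c (g_q) <> c 0], for otherwise
   [(g_q - 0) + (0 - m k b) = b] would be a pairwise monochromatic solution.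
   So [c] decides every computation with values 0 and 1, in particular the search
   for the first level of a tree at which only one of two siblings survives. *)
From HB Require Import structures.
From Stdlib Require Cantor.
Require Import Defs.
From mathcomp Require Import all_boot all_order all_algebra.
From mathcomp Require Import classical_sets cardinality.
From mathcomp Require Import boolp zify ring.

Set Implicit Arguments.
Unset Strict Implicit.
Unset Printing Implicit Defensive.

Import Order.TTheory GRing.Theory Num.Theory.

(** * Closure properties of computable functions *)

Definition pi1 (a : nat) : nat := (Cantor.of_nat a).1.
Definition pi2 (a : nat) : nat := (Cantor.of_nat a).2.
Arguments Cantor.to_nat : simpl never.
Arguments pi1 : simpl never.
Arguments pi2 : simpl never.

Lemma pi1K x y : pi1 <|x, y|> = x.
Proof. by rewrite /pi1 Cantor.cancel_of_to. Qed.

Lemma pi2K x y : pi2 <|x, y|> = y.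
Proof. by rewrite /pi2 Cantor.cancel_of_to. Qed.

Definition piK := (pi1K, pi2K).

Lemma pairK a : <|pi1 a, pi2 a|> = a.
Proof. by rewrite /pi1 /pi2 -surjective_pairing Cantor.cancel_to_of. Qed.

Lemma pair_ge x y : y + x <= <|x, y|>.
Proof. by apply/ssrnat.leP; exact: Cantor.to_nat_non_decreasing. Qed.

Lemma computable_comp g f h : computable_in g f -> computable_in g h ->
  computable_in g (fun x => f (h x)).
Proof. by move=> [e He] [d Hd]; exists (Comp e d) => a; apply: eval_Comp. Qed.

Lemma computable_pair g f h : computable_in g f -> computable_in g h ->
  computable_in g (fun x => <|f x, h x|>).
Proof. by move=> [e He] [d Hd]; exists (Pair e d) => a; apply: eval_Pair. Qed.

Lemma computable_pi1 g f : computable_in g f -> computable_in g (fun x => pi1 (f x)).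
Proof.
apply: computable_comp; exists Fst => a.
by rewrite -[X in eval _ _ X]pairK; apply: eval_Fst.
Qed.

Lemma computable_pi2 g f : computable_in g f -> computable_in g (fun x => pi2 (f x)).
Proof.
apply: computable_comp; exists Snd => a.
by rewrite -[X in eval _ _ X]pairK; apply: eval_Snd.
Qed.

Lemma computable_id g : computable_in g (fun x => x).
Proof.
exists (Pair Fst Snd) => a; rewrite -{1 2}(pairK a).
by apply: eval_Pair; [apply: eval_Fst | apply: eval_Snd].
Qed.

Lemma computable_succ g f : computable_in g f -> computable_in g (fun x => (f x).+1).
Proof. by apply: computable_comp; exists Succ => a; apply: eval_Succ. Qed.

Lemma computable_const g c : computable_in g (fun=> c).
Proof.
elim: c => [|c]; last exact: computable_succ.
by exists Zero => a; apply: eval_Zero.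
Qed.

Lemma computable_oracle g f : computable_in g f -> computable_in g (fun x => g (f x)).
Proof. by apply: computable_comp; exists Oracle => a; apply: eval_Oracle. Qed.

Definition computable2 g (f : nat -> nat -> nat) :=
  computable_in g (fun z => f (pi1 z) (pi2 z)).

Definition computable3 g (f : nat -> nat -> nat -> nat) :=
  computable_in g (fun z => f (pi1 z) (pi1 (pi2 z)) (pi2 (pi2 z))).

Lemma computable_ext g f h : f =1 h -> computable_in g f -> computable_in g h.
Proof. by move=> fh [e He]; exists e => a; rewrite -fh. Qed.

Lemma computable2_app g f a b : computable2 g f ->
  computable_in g a -> computable_in g b -> computable_in g (fun x => f (a x) (b x)).
Proof.
move=> Hf Ha Hb; apply: computable_ext (computable_comp Hf (computable_pair Ha Hb)).
by move=> x; rewrite /= !piK.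
Qed.

Lemma computable3_app g f a b c : computable3 g f ->
  computable_in g a -> computable_in g b -> computable_in g c ->
  computable_in g (fun x => f (a x) (b x) (c x)).
Proof.
move=> Hf Ha Hb Hc; apply: computable_ext
  (computable_comp Hf (computable_pair Ha (computable_pair Hb Hc))).
by move=> x; rewrite /= !piK.
Qed.

Lemma computable2_rec g f i s :
  (forall x, f x 0 = i x) -> (forall x n, f x n.+1 = s x n (f x n)) ->
  computable_in g i -> computable3 g s -> computable2 g f.
Proof.
move=> f0 fS [e He] [d Hd]; exists (Prec e d) => a.
rewrite -[X in eval _ _ X]pairK; elim: (pi2 a) => [|n IHn].
  by rewrite f0; apply: eval_Prec0.
rewrite fS; apply: eval_PrecS IHn _.
by have := Hd <|pi1 a, <|n, f (pi1 a) n|>|>; rewrite !piK.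
Qed.

(* Search with [Mu]: it looks for a zero, hence the negation. *)
Lemma computable_min g (p : nat -> nat -> bool) f :
  (forall a, p a (f a)) -> (forall a j, j < f a -> ~~ p a j) ->
  computable2 g (fun a j => nat_of_bool (~~ p a j)) -> computable_in g f.
Proof.
move=> pf pmin [e He]; exists (Mu e) => a; apply: (@eval_Mu _ _ _ _ (fun=> 0)).
  by move=> j lt_j; have := He <|a, j|>; rewrite !piK pmin.
by have := He <|a, f a|>; rewrite !piK pf.
Qed.

Create HintDb computable discriminated.
#[local] Hint Constants Opaque : computable.
#[local] Hint Resolve computable_const computable_id computable_succ
  computable_pi1 computable_pi2 computable_pair : computable.

Ltac computability :=
  rewrite /computable /computable2 /computable3; cbv beta; auto 200 with nocore computable.

(** The argument [x] is passed along as the parameter of [Prec], so that start, step and number of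
    rounds may all depend on it. *)
Lemma computable_nat_rect g (n i : nat -> nat) (s : nat -> nat -> nat -> nat) :
  computable_in g n -> computable_in g i -> computable3 g s ->
  computable_in g (fun x => nat_rect (fun=> nat) (i x) (s x) (n x)).
Proof.
move=> Hn Hi Hs.
have H : computable2 g (fun x => nat_rect (fun=> nat) (i x) (s x)).
  exact: (@computable2_rec g _ i s).
exact: (computable2_app H (computable_id g) Hn).
Qed.

Lemma computable_iter g (n i : nat -> nat) (s : nat -> nat -> nat) :
  computable_in g n -> computable2 g s -> computable_in g i ->
  computable_in g (fun x => iter (n x) (s x) (i x)).
Proof.
move=> Hn Hs Hi; apply: computable_ext (_ : computable_in g (fun x =>
  nat_rect (fun=> nat) (i x) (fun _ u => s x u) (n x))).
  by move=> x; elim: (n x) => //= m ->.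
apply: computable_nat_rect => //; rewrite /computable3.
by apply: (computable2_app Hs); computability.
Qed.

Lemma computable_pred g f : computable_in g f -> computable_in g (fun x => (f x).-1).
Proof.
move=> Hf; apply: computable_ext (_ : computable_in g (fun x =>
  nat_rect (fun=> nat) 0 (fun i _ => i) (f x))); first by move=> x; case: (f x).
by apply: computable_nat_rect; computability.
Qed.
#[local] Hint Resolve computable_pred : computable.

Lemma computable_add g f h : computable_in g f -> computable_in g h ->
  computable_in g (fun x => f x + h x).
Proof.
move=> Hf Hh; apply: computable_ext (_ : computable_in g (fun x =>
  iter (f x) S (h x))); first by move=> x; rewrite iter_succn addnC.
by apply: computable_iter; computability.
Qed.

Lemma computable_sub g f h : computable_in g f -> computable_in g h ->
  computable_in g (fun x => f x - h x).
Proof.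
move=> Hf Hh; apply: computable_ext (_ : computable_in g (fun x =>
  iter (h x) predn (f x))).
  by move=> x; rewrite iter_predn.
by apply: computable_iter; computability.
Qed.
#[local] Hint Resolve computable_add computable_sub : computable.

Lemma computable_double g f : computable_in g f -> computable_in g (fun x => (f x).*2).
Proof.
move=> Hf; apply: computable_ext (_ : computable_in g (fun x => f x + f x)).
  by move=> x; rewrite addnn.
by computability.
Qed.
#[local] Hint Resolve computable_double : computable.

Lemma computable_if g (b : nat -> bool) f h :
  computable_in g (fun x => nat_of_bool (b x)) ->
  computable_in g f -> computable_in g h ->
  computable_in g (fun x => if b x then f x else h x).
Proof.
move=> Hb Hf Hh; apply: computable_ext (_ : computable_in g (fun x =>
  nat_rect (fun=> nat) (h x) (fun _ _ => f x) (b x))); first by move=> x; case: (b x).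
apply: computable_nat_rect => //; rewrite /computable3.
by apply: (computable_comp Hf); computability.
Qed.
#[local] Hint Resolve computable_if : computable.

Lemma computable_eq0 g f : computable_in g f ->
  computable_in g (fun x => nat_of_bool (f x == 0)).
Proof.
move=> Hf; apply: computable_ext (_ : computable_in g (fun x => 1 - f x)).
  by move=> x; case: (f x) => //= i; rewrite subSS sub0n.
by computability.
Qed.
#[local] Hint Resolve computable_eq0 : computable.

Lemma computable_eqn g f h : computable_in g f -> computable_in g h ->
  computable_in g (fun x => nat_of_bool (f x == h x)).
Proof.
move=> Hf Hh; apply: computable_ext (_ : computable_in g (fun x =>
  nat_of_bool ((f x - h x) + (h x - f x) == 0))).
  by move=> x; rewrite addn_eq0 !subn_eq0 -eqn_leq.
by computability.
Qed.

Lemma computable_neg g (b : nat -> bool) :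
  computable_in g (fun x => nat_of_bool (b x)) ->
  computable_in g (fun x => nat_of_bool (~~ b x)).
Proof.
move=> Hb; apply: computable_ext (_ : computable_in g (fun x => if b x then 0 else 1)).
  by move=> x; case: (b x).
by computability.
Qed.

Lemma computable_and g (b d : nat -> bool) :
  computable_in g (fun x => nat_of_bool (b x)) ->
  computable_in g (fun x => nat_of_bool (d x)) ->
  computable_in g (fun x => nat_of_bool (b x && d x)).
Proof.
move=> Hb Hd.
apply: computable_ext (_ : computable_in g (fun x => if b x then nat_of_bool (d x) else 0)).
  by move=> x; case: (b x).
by computability.
Qed.
#[local] Hint Resolve computable_eqn computable_neg computable_and : computable.

Lemma computable_sum g (n : nat -> nat) (s : nat -> nat -> nat) :
  computable_in g n -> computable2 g s ->
  computable_in g (fun x => \sum_(i < n x) s x i).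
Proof.
move=> Hn Hs; apply: computable_ext (_ : computable_in g (fun x =>
  nat_rect (fun=> nat) 0 (fun i u => u + s x i) (n x))).
  by move=> x; elim: (n x) => [|m /= ->]; rewrite ?big_ord0 ?big_ord_recr.
apply: computable_nat_rect => //; rewrite ?/computable3; computability.
by apply: computable_add; [|apply: (computable2_app Hs)]; computability.
Qed.

Lemma computable_mul g f h : computable_in g f -> computable_in g h ->
  computable_in g (fun x => f x * h x).
Proof.
move=> Hf Hh; apply: computable_ext (_ : computable_in g (fun x =>
  iter (f x) (addn (h x)) 0)); first by move=> x; rewrite mulnC iter_addn_0.
apply: computable_iter; computability.
by apply: computable_add; [apply: (computable_comp Hh)|]; computability.
Qed.
#[local] Hint Resolve computable_mul : computable.

Lemma computable_expn g f h : computable_in g f -> computable_in g h ->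
  computable_in g (fun x => f x ^ h x).
Proof.
move=> Hf Hh; apply: computable_ext (_ : computable_in g (fun x =>
  iter (h x) (muln (f x)) 1)); first by move=> x; rewrite iter_muln_1.
apply: computable_iter; computability.
by apply: computable_mul; [apply: (computable_comp Hf)|]; computability.
Qed.

Lemma computable_fact g f : computable_in g f -> computable_in g (fun x => (f x)`!).
Proof.
move=> Hf; apply: computable_ext (_ : computable_in g (fun x =>
  nat_rect (fun=> nat) 1 (fun i u => i.+1 * u) (f x))).
  by move=> x; elim: (f x) => //= m ->.
by apply: computable_nat_rect; computability.
Qed.
#[local] Hint Resolve computable_expn computable_fact : computable.

(** * A universal machine *)

Definition push (q u : nat) : nat := <|q, u|>.+1.

Definition seq_code (s : seq nat) : nat := foldr push 0 s.

(** The tail of a nonzero code is a smaller number. As every number codes a list, operations on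
    codes need no test of well-formedness. *)
Lemma seq_code_surj u : exists s, seq_code s = u.
Proof.
elim/ltn_ind: u => -[|u] IHu; first by exists [::].
have [|s Hs] := IHu (pi2 u).
  by rewrite ltnS -[leqRHS]pairK (leq_trans (leq_addr _ _) (pair_ge _ _)).
by exists (pi1 u :: s); rewrite /= Hs /push pairK.
Qed.

Lemma size_seq_code s : size s <= seq_code s.
Proof.
elim: s => //= q s IHs.
by rewrite ltnS (leq_trans IHs) // (leq_trans (leq_addr _ _) (pair_ge _ _)).
Qed.

Definition pop (F : nat -> nat -> nat) (z : nat) : nat :=
  if pi2 z == 0 then z else <|F (pi1 z) (pi1 (pi2 z).-1), pi2 (pi2 z).-1|>.

(** The code [u] bounds the length of its list, so [u] rounds suffice; the surplus ones are idle
    because [pop] fixes a state whose list is empty. *)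
Definition fold_code (F : nat -> nat -> nat) (a u : nat) : nat :=
  pi1 (iter u (pop F) <|a, u|>).

Lemma fold_codeE F a s : fold_code F a (seq_code s) = foldl F a s.
Proof.
rewrite /fold_code.
suff -> n : size s <= n -> iter n (pop F) <|a, seq_code s|> = <|foldl F a s, 0|>.
  by rewrite pi1K.
  exact: size_seq_code.
elim: s a n => [|q s IHs] a n /=.
  by move=> _; elim: n => //= n ->; rewrite /pop !piK.
case: n => // n Hn; rewrite iterSr.
suff -> : pop F <|a, push q (seq_code s)|> = <|F a q, seq_code s|> by exact: IHs.
by rewrite /pop /push !piK.
Qed.

Lemma computable_fold_code g (F : nat -> nat -> nat -> nat) a u :
  computable3 g F -> computable_in g a -> computable_in g u ->
  computable_in g (fun x => fold_code (F x) (a x) (u x)).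
Proof.
move=> HF Ha Hu; apply/computable_pi1/computable_iter; computability.
apply: computable_if; computability.
by apply: computable_pair; [apply: (computable3_app HF)|]; computability.
Qed.

(* A stack machine: a state is a pair of a value and a coded stack of
   instructions, each acting on the value.  Instructions with tags 7, 8 and 9 are
   continuations: [7; <v, e>] saves the current value and runs [e] on [v],
   [8; v] pairs [v] with the current value, and [9; <e, <a, i>>] ends a round of
   minimization.  [Oracle] is run with the zero oracle.  The halting states are those with an empty stack. *)
Fixpoint prog_code (e : prog) : nat :=
  match e with
  | Zero | Oracle => <|0, 0|>
  | Succ => <|1, 0|>
  | Fst => <|2, 0|>
  | Snd => <|3, 0|>
  | Pair e1 e2 => <|4, <|prog_code e1, prog_code e2|>|>
  | Comp e1 e2 => <|5, <|prog_code e1, prog_code e2|>|>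
  | Prec e1 e2 => <|6, <|prog_code e1, prog_code e2|>|>
  | Mu e => <|10, prog_code e|>
  end.

(** For tag 6 at a successor, the recursive call yields some [u], the two tags 8 then build the
    argument [<a, <i, u>>], and the step program follows. The last branch is minimization, started
    at 0. *)
Definition exec (t p v K : nat) : nat :=
  if t == 0 then <|0, K|>
  else if t == 1 then <|v.+1, K|>
  else if t == 2 then <|pi1 v, K|>
  else if t == 3 then <|pi2 v, K|>
  else if t == 4 then <|v, push (pi1 p) (push <|7, <|v, pi2 p|>|> K)|>
  else if t == 5 then <|v, push (pi2 p) (push (pi1 p) K)|>
  else if t == 6 then
    if pi2 v == 0 then <|pi1 v, push (pi1 p) K|>
    else <|<|pi1 v, (pi2 v).-1|>, push <|6, p|> (push <|8, (pi2 v).-1|>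
           (push <|8, pi1 v|> (push (pi2 p) K)))|>
  else if t == 7 then <|pi1 p, push (pi2 p) (push <|8, v|> K)|>
  else if t == 8 then <|<|p, v|>, K|>
  else if t == 9 then
    if v == 0 then <|pi2 (pi2 p), K|>
    else let p' := <|pi1 p, <|pi1 (pi2 p), (pi2 (pi2 p)).+1|>|> in
         <|pi2 p', push (pi1 p) (push <|9, p'|> K)|>
  else <|<|v, 0|>, push p (push <|9, <|p, <|v, 0|>|>|> K)|>.

Definition step (z : nat) : nat :=
  if pi2 z == 0 then z
  else exec (pi1 (pi1 (pi2 z).-1)) (pi2 (pi1 (pi2 z).-1)) (pi1 z) (pi2 (pi2 z).-1).

Lemma computable_push g f h : computable_in g f -> computable_in g h ->
  computable_in g (fun x => push (f x) (h x)).
Proof. by move=> Hf Hh; rewrite /push; computability. Qed.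
#[local] Hint Resolve computable_push : computable.

Lemma computable_step g f : computable_in g f -> computable_in g (fun x => step (f x)).
Proof. by move=> Hf; rewrite /step /exec; computability. Qed.
#[local] Hint Resolve computable_step : computable.

Lemma step_push v t p K : step <|v, push <|t, p|> K|> = exec t p v K.
Proof. by rewrite /step /push !piK. Qed.

Definition reaches (z z' : nat) : Prop := exists t, iter t step z = z'.

Lemma reaches_trans z z' z'' : reaches z z' -> reaches z' z'' -> reaches z z''.
Proof. by move=> [t <-] [u <-]; exists (u + t); rewrite iterD. Qed.

Lemma reaches_push v t p K z :
  reaches (exec t p v K) z -> reaches <|v, push <|t, p|> K|> z.
Proof. by move=> [n <-]; exists n.+1; rewrite iterSr step_push. Qed.

Lemma reaches_refl z : reaches z z.
Proof. by exists 0. Qed.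

(** The stack [K] is arbitrary, so that the induction hypotheses apply to subprograms with
    continuations below them. *)
Lemma eval_reaches e a v K : eval (fun=> 0) e a v ->
  reaches <|a, push (prog_code e) K|> <|v, K|>.
Proof.
move=> Hev; elim: Hev K => {e a v} /=; try by move=> *;
  apply: reaches_push; rewrite /exec /= ?piK; exact: reaches_refl.
- move=> e1 e2 a v1 v2 _ IH1 _ IH2 K; apply: reaches_push; rewrite /exec /= !piK.
  apply: reaches_trans (IH1 _) _; apply: reaches_push; rewrite /exec /= !piK.
  apply: reaches_trans (IH2 _) _; apply: reaches_push; exact: reaches_refl.
- move=> e1 e2 a u v _ IH2 _ IH1 K; apply: reaches_push; rewrite /exec /= !piK.
  exact: reaches_trans (IH2 _) _.
- move=> e1 e2 a v _ IH K; apply: reaches_push; rewrite /exec /= !piK /=.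
  exact: IH.
- move=> e1 e2 a i u v _ IH1 _ IH2 K; apply: reaches_push; rewrite /exec /= !piK /=.
  apply: reaches_trans (IH1 _) _; do 2!apply: reaches_push; exact: IH2.
- move=> e a i w _ IHw _ IH K; apply: reaches_push; rewrite /exec /=.
  set z := (X in reaches X _).
  (* Loop invariant: the values at arguments below [j] being nonzero, the machine comes to the start
     of round [j]. *)
  suff H j : j <= i -> reaches z <|<|a, j|>,
      push (prog_code e) (push <|9, <|prog_code e, <|a, j|>|>|> K)|>.
    apply: reaches_trans (H i _) _ => //; apply: reaches_trans (IH _) _.
    by apply: reaches_push; rewrite /exec /= !piK; exact: reaches_refl.
  elim: j => [|j IHj] ltji; first exact: reaches_refl.
  apply: reaches_trans (IHj (ltnW ltji)) _; apply: reaches_trans (IHw j ltji _) _.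
  by apply: reaches_push; rewrite /exec /= !piK; exact: reaches_refl.
Qed.

(** * Running times and weights *)

Definition halted (q s : nat) : bool := pi2 (iter s step q) == 0.

Lemma step_halted z : pi2 z = 0 -> step z = z.
Proof. by rewrite /step => ->. Qed.

Lemma halted_iter q s t : halted q s -> s <= t -> iter t step q = iter s step q.
Proof.
move=> /eqP Hs /subnK <-; rewrite iterD.
by elim: (t - s) => //= n ->; rewrite step_halted.
Qed.

Lemma halted_le q s t : s <= t -> halted q s -> halted q t.
Proof. by move=> st Hs; rewrite /halted (halted_iter Hs st). Qed.

(** This is the minimum of [B] and the halting time of [q], hence computable even where [q] runs
    forever. *)
Definition runtime (q B : nat) : nat := \sum_(s < B) ~~ halted q s.

(** The integer that stands for [g_q] at stage [B]. Pairing the running time with [q] makes the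
    numbers under the factorial distinct for distinct states. *)
Definition weight (q B : nat) : nat :=
  <|q, runtime q B|>`! + (halted q B && (pi1 (iter B step q) == 1)).

Lemma runtime_running q B : ~~ halted q B -> runtime q B = B.
Proof.
move=> nH; rewrite -[RHS](card_ord B) -sum1_card; apply: eq_bigr => i _.
by rewrite (contra (halted_le (ltnW (ltn_ord i))) nH).
Qed.

Lemma runtime_halted q s B : halted q s -> s <= B -> runtime q B = runtime q s.
Proof.
move=> Hs /subnKC <-; rewrite /runtime big_split_ord /= [X in _ + X]big1 ?addn0 // => i _.
by rewrite (halted_le (leq_addr _ _) Hs).
Qed.

Lemma weight_halted q s B : halted q s -> s <= B -> weight q B = weight q s.
Proof.
move=> Hs sB; rewrite /weight (runtime_halted Hs sB) (halted_iter Hs sB).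
by rewrite Hs (halted_le sB Hs).
Qed.

Lemma leq_runtime q : {homo runtime q : B C / B <= C}.
Proof. by move=> B C /subnKC <-; rewrite /runtime big_split_ord leq_addr. Qed.

(** A state still running at [B0] has running time at least [B0] from then on; so [q] has halted by
    [B0] and its weight is final. *)
Lemma weight_stable q B0 B C : B0 <= B -> B0 <= C -> runtime q B < B0 ->
  weight q B = weight q C.
Proof.
move=> B0B B0C Hr; have [HB0|nH] := boolP (halted q B0).
  by rewrite !(weight_halted HB0).
by have := leq_ltn_trans (leq_runtime q B0B) Hr; rewrite runtime_running // ltnn.
Qed.

(* The state [0 = <0, 0>] has an empty stack and value 0, so that [g_0] can serve
   as the element [b] of which the other generators become multiples. *)
Lemma weight0 B : weight 0 B = 1.
Proof.
have H0 : halted 0 0 by rewrite /halted /= -[0](@pi2K 0 0).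
by rewrite (weight_halted H0) // /weight /runtime big_ord0 H0.
Qed.

Lemma reaches_weight q v : reaches q <|v, 0|> ->
  exists B0 T, [/\ q <= T & forall B, B0 <= B -> weight q B = T`! + (v == 1)].
Proof.
move=> [s Hs]; have H : halted q s by rewrite /halted Hs piK.
exists s, <|q, runtime q s|>; split=> [|B sB].
  exact: leq_trans (leq_addl _ _) (pair_ge _ _).
by rewrite (weight_halted H sB) /weight H Hs piK.
Qed.

Lemma computable_weight g f h : computable_in g f -> computable_in g h ->
  computable_in g (fun x => weight (f x) (h x)).
Proof.
have Hst : computable2 g (fun q s => iter s step q).
  by apply: computable_iter; computability.
have Hh : computable2 g (fun q s => nat_of_bool (halted q s)).
  by apply: computable_eq0; computability.
have Hr : computable2 g runtime.
  apply: (@computable_sum g _ (fun z i => nat_of_bool (~~ halted (pi1 z) i))); computability.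
  by apply: computable_neg; apply: (computable2_app Hh); computability.
apply: (@computable2_app g weight); apply: computable_add.
  by apply/computable_fact/computable_pair; computability.
apply: computable_and; first exact: Hh.
by apply: computable_eqn; computability.
Qed.
#[local] Hint Resolve computable_weight : computable.

(** * The group *)

Lemma exists_seq_argmax (T : eqType) (f : T -> nat) x (s : seq T) : x \in s ->
  exists2 y, y \in s & forall z, z \in s -> f z <= f y.
Proof.
elim: s x => // y [|y' s] IHs x _.
  by exists y; rewrite ?mem_head // => z; rewrite inE => /eqP ->.
have [z sz Hz] := IHs y' (mem_head _ _); have [yz|zy] := leqP (f y) (f z).
  exists z; first by rewrite in_cons sz orbT.
  by move=> t; rewrite in_cons => /predU1P[->|/Hz].
exists y; first exact: mem_head.
move=> t; rewrite in_cons => /predU1P[-> //|/Hz tz].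
exact: leq_trans tz (ltnW zy).
Qed.

(** Each weight in [s2] is at most [(T-1)! + 1], hence at most [2 (T-1)!]. Their sum is at most
    [2 |s2| (T-1)!], which is below [T!] and so below the weight of [q] alone. *)
Lemma ltn_sum_weight s1 s2 B q :
  q \in s1 -> (forall q', q' \in s2 -> <|q', runtime q' B|> < <|q, runtime q B|>) ->
  (size s2).*2 < <|q, runtime q B|> ->
  \sum_(q' <- s2) weight q' B < \sum_(q' <- s1) weight q' B.
Proof.
set T := <|q, _|> => s1q Hs2 HT; apply: (@leq_trans T`!).
  have T0 : 0 < T by apply: leq_ltn_trans HT.
  rewrite -(prednK T0) factS (prednK T0).
  apply: (@leq_ltn_trans ((size s2).*2 * T.-1`!)); last by rewrite ltn_pmul2r ?fact_gt0.
  rewrite -muln2 -mulnA -sum1_size big_distrl /= !big_seq.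
  apply: leq_sum => q' /Hs2; rewrite -ltnS => lt_T.
  rewrite mul1n mul2n -addnn leq_add // ?fact_gt0 //.
    by apply: leq_fact; rewrite -ltnS (prednK T0).
  by rewrite (leq_trans (leq_b1 _)) // fact_gt0.
rewrite (perm_big _ (perm_to_rem s1q)) big_cons (leq_trans _ (leq_addr _ _)) //.
by rewrite /weight -/T leq_addr.
Qed.

(** The largest [<q, runtime q B>] is attained by a single state, which occurs in only one of the
    two disjoint lists; the sum over that list is larger. *)
Lemma sum_weight_neq s1 s2 B : ~~ has (mem s1) s2 ->
  (exists2 q, q \in s1 ++ s2 & (size s1 + size s2).*2 < <|q, runtime q B|>) ->
  \sum_(q <- s1) weight q B <> \sum_(q <- s2) weight q B.
Proof.
move=> dis [q0 q0s Hq0].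
have [q qs Hmax] := exists_seq_argmax (fun q => <|q, runtime q B|>) q0s.
have Hq := leq_trans Hq0 (Hmax _ q0s).
have lt_max t u : q \in t -> {subset u <= s1 ++ s2} -> ~~ has (mem t) u ->
    size u <= size s1 + size s2 ->
    \sum_(q' <- u) weight q' B < \sum_(q' <- t) weight q' B.
  move=> tq us /hasPn tu Hu; apply: (ltn_sum_weight tq); last first.
    by apply: leq_ltn_trans Hq; rewrite leq_double.
  move=> q' uq'; rewrite ltn_neqAle Hmax ?us // andbT.
  apply/eqP => /(congr1 pi1); rewrite !pi1K => qq'.
  by have := tu _ uq'; rewrite qq' /= tq.
move: qs; rewrite mem_cat => /orP[qs1|qs2] E.
  have := lt_max s1 s2 qs1; rewrite E ltnn => /(_ _ dis) H.
  by suff: false by []; apply: H (leq_addl _ _) => x xs; rewrite mem_cat xs orbT.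
have := lt_max s2 s1 qs2; rewrite E ltnn has_sym => /(_ _ dis) H.
by suff: false by []; apply: H (leq_addr _ _) => x xs; rewrite mem_cat xs.
Qed.

(* Common generators are cancelled first.  Then either every remaining generator
   has halted before [B0], so that no weight changes any more, or a largest
   weight dominates the sum it does not occur in. *)
Lemma sum_weight_stable s1 s2 B0 B C : (size s1 + size s2).*2 < B0 ->
  B0 <= B -> B0 <= C ->
  \sum_(q <- s1) weight q B = \sum_(q <- s2) weight q B ->
  \sum_(q <- s1) weight q C = \sum_(q <- s2) weight q C.
Proof.
move=> + B0B B0C; have [n] := ubnP (size s1); elim: n s1 s2 => // n IHn s1 s2.
rewrite ltnS => Hn Hs; have [/hasP[q s2q /= s1q]|dis] := boolP (has (mem s1) s2).
  rewrite !(perm_big _ (perm_to_rem s1q)) !(perm_big _ (perm_to_rem s2q)) /=.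
  rewrite !big_cons => /addnI E; congr addn; apply: IHn E.
    by rewrite size_rem // prednK //; case: (s1) s1q.
  by apply: leq_ltn_trans Hs; rewrite !size_rem // leq_double leq_add ?leq_pred.
have [/allP Hall|/allPn[q qs]] := boolP (all (fun q => <|q, runtime q B|> < B0) (s1 ++ s2)).
  have W q : q \in s1 ++ s2 -> weight q B = weight q C.
    move=> /Hall Hq; apply: (weight_stable B0B B0C).
    exact: leq_ltn_trans (leq_trans (leq_addr _ _) (pair_ge _ _)) Hq.
  have E t : {subset t <= s1 ++ s2} ->
      \sum_(q <- t) weight q B = \sum_(q <- t) weight q C.
    by move=> ts; rewrite !big_seq; apply: eq_bigr => q /ts /W.
  by rewrite !E // => q qs; rewrite mem_cat qs ?orbT.
rewrite -leqNgt => Hq; case/(sum_weight_neq dis); exists q => //.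
exact: leq_trans Hs Hq.
Qed.

(** * Codes of integer combinations of generators *)

Definition total_weight (u B : nat) : nat := fold_code (fun a q => a + weight q B) 0 u.

Lemma total_weightE s B : total_weight (seq_code s) B = \sum_(q <- s) weight q B.
Proof.
rewrite /total_weight fold_codeE.
suff H a : foldl (fun a q => a + weight q B) a s = a + \sum_(q <- s) weight q B by rewrite H.
by elim: s a => [|q s IHs] a /=; rewrite ?big_nil ?addn0 // IHs big_cons addnA.
Qed.

(** The entries of [u] arrive in reverse order, which is harmless because total weights ignore
    order. *)
Definition append (u v : nat) : nat := fold_code (fun a q => push q a) v u.

Lemma total_weight_append u v B :
  total_weight (append u v) B = total_weight u B + total_weight v B.
Proof.
have [[s <-] [t <-]] := (seq_code_surj u, seq_code_surj v).
rewrite /append fold_codeE.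
suff -> : foldl (fun a q => push q a) (seq_code t) s = seq_code (catrev s t).
  by rewrite !total_weightE catrevE big_cat big_rev.
by elim: s t => //= q s IHs t; rewrite -(IHs (q :: t)).
Qed.

Lemma computable_total_weight g f h : computable_in g f -> computable_in g h ->
  computable_in g (fun x => total_weight (f x) (h x)).
Proof.
move=> Hf Hh; apply: computable_fold_code; computability.
apply: computable_add; computability.
by apply: computable_weight; [|apply: (computable_comp Hh)]; computability.
Qed.

Lemma computable_append g f h : computable_in g f -> computable_in g h ->
  computable_in g (fun x => append (f x) (h x)).
Proof. by move=> Hf Hh; apply: computable_fold_code; computability. Qed.
#[local] Hint Resolve computable_total_weight computable_append : computable.

(** A code is a pair of lists, the positive and the negative part of an integer combination;
    coefficients are expressed by repetition. *)
Definition germ (a B : nat) : int :=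
  ((total_weight (pi1 a) B)%:Z - (total_weight (pi2 a) B)%:Z)%R.

Definition eventually_eq (u v : nat -> int) : Prop :=
  exists B0, forall B, B0 <= B -> u B = v B.

Lemma eventually_eq_refl u : eventually_eq u u.
Proof. by exists 0. Qed.

Lemma eventually_eq_sym u v : eventually_eq u v -> eventually_eq v u.
Proof. by move=> [B0 H]; exists B0 => B /H. Qed.

Lemma eventually_eq_trans u v w :
  eventually_eq u v -> eventually_eq v w -> eventually_eq u w.
Proof.
move=> [B0 H] [B1 H1]; exists (maxn B0 B1) => B; rewrite geq_max => /andP[HB0 HB1].
by rewrite H ?H1.
Qed.

Lemma eventually_eqD u v u' v' : eventually_eq u v -> eventually_eq u' v' ->
  eventually_eq (fun B => u B + u' B)%R (fun B => v B + v' B)%R.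
Proof.
move=> [B0 H] [B1 H1]; exists (maxn B0 B1) => B; rewrite geq_max => /andP[HB0 HB1].
by rewrite H ?H1.
Qed.

(** Codes dominate the lengths of their lists, so this exceeds twice the number of entries in the
    four lists, as [sum_weight_stable] requires. *)
Definition germ_bound (a a' : nat) : nat := (a + a' + (a + a')).+1.

Definition same_germ (a a' : nat) : bool :=
  total_weight (pi1 a) (germ_bound a a') + total_weight (pi2 a') (germ_bound a a') ==
  total_weight (pi1 a') (germ_bound a a') + total_weight (pi2 a) (germ_bound a a').

(** By [sum_weight_stable], equality at one stage from the bound on transfers to every other such
    stage, later or earlier. One comparison at the bound thus decides eventual equality. *)
Lemma same_germP a a' : reflect (eventually_eq (germ a) (germ a')) (same_germ a a').
Proof.
rewrite /same_germ; set B0 := germ_bound a a'.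
have germE C : germ a C = germ a' C <->
    total_weight (pi1 a) C + total_weight (pi2 a') C =
    total_weight (pi1 a') C + total_weight (pi2 a) C.
  by rewrite /germ; split; lia.
have stable B C : B0 <= B -> B0 <= C -> germ a B = germ a' B -> germ a C = germ a' C.
  move=> B0B B0C; rewrite !germE.
  have [s1 E1] := seq_code_surj (pi1 a); have [t1 E1'] := seq_code_surj (pi1 a').
  have [s2 E2] := seq_code_surj (pi2 a); have [t2 E2'] := seq_code_surj (pi2 a').
  rewrite -E1 -E2 -E1' -E2' !total_weightE -!big_cat.
  apply: sum_weight_stable B0B B0C; rewrite !size_cat.
  have := size_seq_code s1; have := size_seq_code s2.
  have := size_seq_code t1; have := size_seq_code t2.
  have := pair_ge (pi1 a) (pi2 a); have := pair_ge (pi1 a') (pi2 a').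
  rewrite E1 E2 E1' E2' !pairK /B0 /germ_bound; lia.
apply: (iffP eqP) => [/germE H|[B1 H]].
  by exists B0 => B B0B; apply: stable H.
apply/germE; apply: (stable (maxn B0 B1)); rewrite ?leq_maxl //.
by apply: H; rewrite leq_maxr.
Qed.

(** * Least codes as normal forms *)

Lemma exists_same_germ a : exists a', same_germ a' a.
Proof. by exists a; apply/same_germP; exact: eventually_eq_refl. Qed.

Definition least_code (a : nat) : nat := ex_minn (exists_same_germ a).

Lemma germ_least_code a : eventually_eq (germ (least_code a)) (germ a).
Proof. by rewrite /least_code; case: ex_minnP => a' /same_germP. Qed.

Lemma least_code_min a a' : eventually_eq (germ a') (germ a) -> least_code a <= a'.
Proof. by move=> /same_germP E; rewrite /least_code; case: ex_minnP => m _ /(_ a' E). Qed.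

Lemma least_code_inj a a' : eventually_eq (germ a) (germ a') -> least_code a = least_code a'.
Proof.
move=> E; apply/eqP; rewrite eqn_leq; apply/andP; split; apply: least_code_min.
  exact: eventually_eq_trans (germ_least_code a') (eventually_eq_sym E).
exact: eventually_eq_trans (germ_least_code a) E.
Qed.

Lemma least_code_idem a : least_code (least_code a) = least_code a.
Proof. exact/least_code_inj/germ_least_code. Qed.

Lemma computable_least_code g f : computable_in g f ->
  computable_in g (fun x => least_code (f x)).
Proof.
apply: computable_comp; apply: (@computable_min _ (fun a j => same_germ j a)).
- by move=> a; apply/same_germP; exact: germ_least_code.
- by move=> a j; apply: contraL => /same_germP /least_code_min; rewrite leqNgt.
- by rewrite /same_germ /germ_bound; computability.
Qed.
#[local] Hint Resolve computable_least_code : computable.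

Definition germ_elt : Type := {a : nat | least_code a == a}.
HB.instance Definition _ := Choice.on germ_elt.

Definition to_elt (a : nat) : germ_elt :=
  exist _ (least_code a) (introT eqP (least_code_idem a)).

Definition elt_germ (x : germ_elt) : nat -> int := germ (val x).

(** Elements are their own least codes, hence determined by their germs. The group axioms thereby
    reduce to identities between integers at each stage. *)
Lemma elt_germ_inj x y : eventually_eq (elt_germ x) (elt_germ y) -> x = y.
Proof.
move=> /least_code_inj E; apply/val_inj.
by rewrite -(eqP (valP x)) E (eqP (valP y)).
Qed.

(** * Group operations *)

Definition add_code (a a' : nat) : nat :=
  <|append (pi1 a) (pi1 a'), append (pi2 a) (pi2 a')|>.

Definition opp_code (a : nat) : nat := <|pi2 a, pi1 a|>.

Definition add_elt (x y : germ_elt) : germ_elt := to_elt (add_code (val x) (val y)).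
Definition opp_elt (x : germ_elt) : germ_elt := to_elt (opp_code (val x)).
Definition zero_elt : germ_elt := to_elt 0.

Lemma elt_germ_to_elt a : eventually_eq (elt_germ (to_elt a)) (germ a).
Proof. exact: germ_least_code. Qed.

Lemma elt_germD x y :
  eventually_eq (elt_germ (add_elt x y)) (fun B => elt_germ x B + elt_germ y B)%R.
Proof.
apply: eventually_eq_trans (elt_germ_to_elt _) _; exists 0 => B _.
by rewrite /elt_germ /germ /add_code !piK !total_weight_append !PoszD; ring.
Qed.

Lemma elt_germN x : eventually_eq (elt_germ (opp_elt x)) (fun B => - elt_germ x B)%R.
Proof.
apply: eventually_eq_trans (elt_germ_to_elt _) _; exists 0 => B _.
by rewrite /elt_germ /germ /opp_code !piK opprB.
Qed.

Lemma elt_germ0 : eventually_eq (elt_germ zero_elt) (fun=> 0%R).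
Proof.
apply: eventually_eq_trans (elt_germ_to_elt _) _; exists 0 => B _.
have -> : 0 = <|0, 0|> by [].
by rewrite /germ !piK subrr.
Qed.

Fact add_eltA : associative add_elt.
Proof.
move=> x y z; apply: elt_germ_inj.
apply: eventually_eq_trans (elt_germD _ _) _.
apply: eventually_eq_trans (eventually_eqD (eventually_eq_refl _) (elt_germD _ _)) _.
apply: eventually_eq_sym; apply: eventually_eq_trans (elt_germD _ _) _.
apply: eventually_eq_trans (eventually_eqD (elt_germD _ _) (eventually_eq_refl _)) _.
by exists 0 => B _; exact: (esym (addrA _ _ _)).
Qed.

Fact add_eltC : commutative add_elt.
Proof.
move=> x y; apply: elt_germ_inj; apply: eventually_eq_trans (elt_germD _ _) _.
apply: eventually_eq_sym; apply: eventually_eq_trans (elt_germD _ _) _.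
by exists 0 => B _; rewrite addrC.
Qed.

Fact add_0elt : left_id zero_elt add_elt.
Proof.
move=> x; apply: elt_germ_inj; apply: eventually_eq_trans (elt_germD _ _) _.
apply: eventually_eq_trans (eventually_eqD elt_germ0 (eventually_eq_refl _)) _.
by exists 0 => B _; rewrite add0r.
Qed.

Fact add_oppelt : left_inverse zero_elt opp_elt add_elt.
Proof.
move=> x; apply: elt_germ_inj; apply: eventually_eq_trans (elt_germD _ _) _.
apply: eventually_eq_trans (eventually_eqD (elt_germN x) (eventually_eq_refl _)) _.
apply: eventually_eq_sym; apply: eventually_eq_trans elt_germ0 _.
by exists 0 => B _; rewrite addNr.
Qed.

HB.instance Definition _ :=
  GRing.isZmodule.Build germ_elt add_eltA add_eltC add_0elt add_oppelt.

Definition weight_group : natGroup :=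
  @NatGroup (fun a => least_code a == a) (GRing.Zmodule.class germ_elt).

Lemma weight_group_computable : computable_group weight_group.
Proof.
split.
- by exists (fun a => least_code a == a) => //; computability.
- exists (fun z => least_code (add_code (pi1 z) (pi2 z))).
    by rewrite /add_code; computability.
  by move=> x y; rewrite !piK.
- exists (fun a => least_code (opp_code a)); first by rewrite /opp_code; computability.
  by [].
Qed.

(** * Surviving nodes of a binary tree *)

Definition child (S : nat) (b : bool) : nat := (S.*2 + b).+1.

Lemma string_code_rcons s b : string_code (rcons s b) = child (string_code s) b.
Proof. by rewrite /string_code foldl_rcons. Qed.

Lemma child_inj S b S' b' : child S b = child S' b' -> S = S' /\ b = b'.
Proof. rewrite /child; case: b b' => [] [] /=; lia. Qed.

Lemma string_code_inj : injective string_code.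
Proof.
move=> s; elim/last_ind: s => [|s b IHs] t; case/lastP: t => [|t b'] //;
  rewrite !string_code_rcons //.
by case/child_inj => /IHs -> ->.
Qed.

(** In binary, the shifted code is the digit 1 followed by the string [s]. *)
Lemma string_codeS s : exists2 j, j < 2 ^ size s & (string_code s).+1 = 2 ^ size s + j.
Proof.
elim/last_ind: s => [|s b [j Hj E]]; first by exists 0.
exists (j.*2 + b); rewrite ?string_code_rcons /child size_rcons expnS; case: b; lia.
Qed.

(* Shifted by one, the codes of the descendants of [S] that are [l] levels further
   down form the interval from [2 ^ l * S.+1] to [2 ^ l * S.+2 - 1]. *)
Definition extends (chi : pred nat) (S l : nat) : bool :=
  \sum_(j < 2 ^ l) chi (2 ^ l * S.+1 + j).-1 != 0.

Lemma computable_extends g (chi : pred nat) f h :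
  computable_in g (fun a => nat_of_bool (chi a)) ->
  computable_in g f -> computable_in g h ->
  computable_in g (fun x => nat_of_bool (extends chi (f x) (h x))).
Proof.
move=> Hchi Hf Hh; rewrite /extends; apply: computable_neg; apply: computable_eq0.
apply: (@computable_sum g _ (fun x j => chi (2 ^ h x * (f x).+1 + j).-1)).
  by computability.
apply: (computable_comp Hchi); apply/computable_pred/computable_add; computability.
apply: computable_mul.
  by apply: (computable_comp (f := fun x => 2 ^ h x)); computability.
by apply: computable_succ; apply: (computable_comp Hf); computability.
Qed.

Lemma extendsP (chi : pred nat) S l :
  reflect (exists2 j, j < 2 ^ l & chi (2 ^ l * S.+1 + j).-1) (extends chi S l).
Proof.
rewrite /extends sum_nat_eq0 negb_forall.
apply: (iffP existsP) => [[j]|[j Hj Hc]].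
  by rewrite /= eqb0 negbK => Hc; exists j.
by exists (Ordinal Hj); rewrite /= Hc.
Qed.

Lemma extends0 (chi : pred nat) S : extends chi S 0 = chi S.
Proof. rewrite /extends big_ord1 eqb0 negbK; congr chi; rewrite /=; lia. Qed.

Lemma extendsS (chi : pred nat) S l :
  extends chi S l.+1 = extends chi (child S false) l || extends chi (child S true) l.
Proof.
have pow : 2 ^ l.+1 = 2 ^ l + 2 ^ l by rewrite expnS mul2n addnn.
(* The interval of descendants splits at [2 ^ l]: its first half lies below the left child, its
   second half below the right one. *)
have E0 j : 2 ^ l * (child S false).+1 + j = 2 ^ l.+1 * S.+1 + j.
  by rewrite pow /child; nia.
have E1 j : 2 ^ l * (child S true).+1 + j = 2 ^ l.+1 * S.+1 + (2 ^ l + j).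
  by rewrite pow /child; nia.
apply/extendsP/orP => [[j Hj Hc]|[]/extendsP[j Hj]].
- have [lt_j|le_j] := ltnP j (2 ^ l); [left | right]; apply/extendsP.
    by exists j; rewrite ?E0.
  by exists (j - 2 ^ l); rewrite ?E1 ?subnKC //; lia.
- by rewrite E0 => Hc; exists j => //; lia.
- by rewrite E1 => Hc; exists (2 ^ l + j) => //; lia.
Qed.

Definition parent_closed (chi : pred nat) : Prop :=
  forall S b, chi (child S b) -> chi S.

Lemma extends_le (chi : pred nat) S k l : parent_closed chi ->
  k <= l -> extends chi S l -> extends chi S k.
Proof.
move=> chi_parent /subnK <-; elim: (l - k) => // n IHn; rewrite addSn => H; apply: IHn.
elim: (n + k) S H => [|m IHm] S; rewrite extendsS.
  by rewrite !extends0 => /orP[] /chi_parent.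
by move=> H; rewrite extendsS; case/orP: H => /IHm ->; rewrite ?orbT.
Qed.

Lemma extends_survivor (chi : pred nat) S b : (forall l, extends chi S l) ->
  (forall l, extends chi (child S (~~ b)) l -> extends chi (child S b) l) ->
  forall l, extends chi (child S b) l.
Proof.
by move=> HS Hb l; have := HS l.+1; rewrite extendsS; case: (b) Hb => /= Hb /orP[] // /Hb.
Qed.

(* The unused component [p] leaves room for padding. *)
Lemma survivor_prog (chi : pred nat) : computable (fun a => nat_of_bool (chi a)) ->
  exists e, forall S p l,
    extends chi (child S false) l != extends chi (child S true) l ->
    (forall k, k < l ->
       extends chi (child S false) k = extends chi (child S true) k) ->
    eval (fun=> 0) e <|S, p|> (extends chi (child S true) l).
Proof.
move=> Hchi.
have Hext b : computable (fun z =>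
    nat_of_bool (extends chi (child (pi1 (pi1 z)) b) (pi2 z))).
  by apply: computable_extends => //; rewrite /child; computability.
(* The function computed by [d] is zero exactly at the levels where the siblings differ, as the
   search by [Mu] demands. *)
have [d Hd] : computable (fun z => nat_of_bool (nat_of_bool
    (extends chi (child (pi1 (pi1 z)) false) (pi2 z)) ==
    extends chi (child (pi1 (pi1 z)) true) (pi2 z))).
  exact: (computable_eqn (Hext false) (Hext true)).
have [v Hv] := Hext true; have [i Hi] := computable_id (fun=> 0).
exists (Comp v (Pair i (Mu d))) => S p l Hl Hmin.
apply: (@eval_Comp _ _ _ _ <|<|S, p|>, l|>); last first.
  by have := Hv <|<|S, p|>, l|>; rewrite !piK.
apply: eval_Pair => //; apply: (@eval_Mu _ _ _ _ (fun=> 0)) => [k /Hmin E|].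
  by have := Hd <|<|S, p|>, k|>; rewrite !piK E eqxx.
by have := Hd <|<|S, p|>, l|>; rewrite !piK; case: extends Hl => //; case: extends.
Qed.

(** Where the siblings agree, either choice is sound. If they ever differ, the choice falls on the
    one alive at the first such level, and by [extends_le] the other is dead from there on. *)
Lemma extends_decided (chi : pred nat) (d : nat -> bool) S : parent_closed chi ->
  (forall l, extends chi (child S false) l != extends chi (child S true) l ->
    (forall k, k < l ->
       extends chi (child S false) k = extends chi (child S true) k) ->
    d S = extends chi (child S true) l) ->
  (forall l, extends chi S l) -> forall l, extends chi (child S (d S)) l.
Proof.
move=> chi_parent Hd HS; apply: extends_survivor => // k Hk.
have [E|neq] := eqVneq (extends chi (child S false) k) (extends chi (child S true) k).
  by case: (d S) Hk => /=; rewrite E.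
have [l Hl Hmin] := ex_minnP (ex_intro (fun l => extends chi (child S false) l !=
  extends chi (child S true) l) k neq).
have lk := Hmin _ neq.
have {}Hd : d S = extends chi (child S true) l.
  apply: Hd => // i ltil; have [//|/Hmin] := eqVneq (extends chi (child S false) i)
    (extends chi (child S true) i); by rewrite leqNgt ltil.
move: Hk => /(extends_le chi_parent lk); move: Hd Hl.
by case: (d S) => /= <-; case: extends.
Qed.

(** If level [l] were empty, closure under prefixes would leave only strings shorter than [l]; their
    codes are below [2 ^ l], so [T] would be finite. *)
Lemma infinite_tree_size (T : set (seq bool)) l : binary_tree T -> infinite_set T ->
  exists2 t, T t & size t = l.
Proof.
move=> HT infT; apply: contrapT => nT; apply: infT.
apply: (@sub_finite_set _ _ (string_code @^-1` `I_(2 ^ l))%classic); last first.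
  by apply: finite_preimage (finite_II _) => s t _ _; exact: string_code_inj.
move=> t Tt /=; have [lt_t|le_l] := ltnP (size t) l; last first.
  case: nT; exists (take l t); last by rewrite size_takel.
  by apply: HT Tt; rewrite -{2}(cat_take_drop l t) prefix_prefix.
have [j Hj E] := string_codeS t.
have : 2 ^ (size t).+1 <= 2 ^ l by rewrite leq_exp2l.
rewrite expnS; lia.
Qed.

(** * The coloring *)

Definition generator_code (q : nat) : nat := <|push q 0, 0|>.

Definition generator (q : nat) : weight_group := to_elt (generator_code q).

Lemma elt_germ_generator q :
  eventually_eq (elt_germ (generator q)) (fun B => (weight q B)%:Z)%R.
Proof.
apply: eventually_eq_trans (elt_germ_to_elt _) _; exists 0 => B _.
rewrite /germ /generator_code !piK (total_weightE [:: q]) (total_weightE [::]).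
by rewrite big_seq1 big_nil subr0.
Qed.

Local Open Scope ring_scope.

Lemma elt_germMn (x : weight_group) (n : nat) :
  eventually_eq (elt_germ (x *+ n)) (fun B => elt_germ x B *+ n).
Proof.
elim: n => [|n IHn]; first exact: elt_germ0.
rewrite mulrS; apply: eventually_eq_trans (elt_germD _ _) _.
apply: eventually_eq_trans (eventually_eqD (eventually_eq_refl _) IHn) _.
by exists 0%N => B _; rewrite mulrS.
Qed.

Lemma generator_neq0 : generator 0 != 0.
Proof.
apply/eqP => E; have [B0 H0] := elt_germ_generator 0; rewrite E in H0.
have [B1 H1] := elt_germ0.
have := H0 _ (leq_maxl B0 B1); rewrite (H1 _ (leq_maxr B0 B1)) weight0.
by [].
Qed.

(** The germ of [generator q] is eventually the constant [T! + v], and that of [generator 0] is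
    eventually 1. *)
Lemma generator_halts q (v : bool) : reaches q <|nat_of_bool v, 0|>%N ->
  exists2 T, (q <= T)%N & generator q = generator 0 *+ (T`! + v).
Proof.
move=> /reaches_weight[B0 [T [qT HW]]]; exists T => //; apply: elt_germ_inj.
apply: eventually_eq_trans (elt_germ_generator q) _; apply: eventually_eq_sym.
apply: eventually_eq_trans (elt_germMn _ _) _.
have [B1 H1] := elt_germ_generator 0; exists (maxn B0 B1) => B.
rewrite geq_max => /andP[/HW -> /H1 ->].
rewrite weight0 (_ : (nat_of_bool v == 1%N) = v); last by case: (v).
exact: natz.
Qed.

Lemma sum_two (G : zmodType) n (i0 i1 : 'I_n) (u v : G) :
  \sum_(i < n) ((if i == i0 then u else 0) - (if i == i1 then v else 0)) = u - v.
Proof. by rewrite sumrB -!big_mkcond !big_pred1_eq. Qed.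

Lemma halting_color (n k : nat) (c : weight_group -> 'I_k) (m q : nat) (v : bool) :
  (2 <= n)%N ->
  ~ (exists x y : 'I_n -> weight_group,
       \sum_(i < n) (x i - y i) = generator 0 /\ pairwise_monochromatic c x y) ->
  (forall j : nat, c (generator 0 *+ (j * m)) = c 0) -> (0 < m <= q)%N ->
  reaches q <|nat_of_bool v, 0|>%N -> (c (generator q) != c 0) = v.
Proof.
move=> n2 nsol Hm /andP[m0 mq] /generator_halts[T qT ->].
have /dvdnP[j ->] : (m %| T`!)%N by rewrite dvdn_fact // m0 (leq_trans mq).
case: v; last by rewrite addn0 Hm eqxx.
apply/eqP => E; apply: nsol.
(* The hypothesis [2 <= n] provides two distinct indices for the two nontrivial pairs; all other
   pairs are [(0, 0)]. *)
pose i0 := Ordinal (ltnW n2); pose i1 := Ordinal n2.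
exists (fun i => if i == i0 then generator 0 *+ (j * m + 1) else 0).
exists (fun i => if i == i1 then generator 0 *+ (j * m) else 0).
split; first by rewrite sum_two mulrnDr mulr1n addrC addKr.
move=> i; have [->|_] := eqVneq i i0; first by rewrite E.
by case: ifP.
Qed.

Lemma coloring_oracle_least_code k (c : weight_group -> 'I_k) a :
  coloring_oracle c (least_code a) = c (to_elt a).
Proof. by rewrite /coloring_oracle -[least_code a]/(val (to_elt a)) valK. Qed.

Theorem theorem3p2 (n : nat) (hn : (2 <= n)%N) :
  exists (G : natGroup) (b : G),
    [/\ computable_group G,
        b != 0 &
        forall c : G -> 'I_(2 * n),
          ~ (exists x y : 'I_n -> G,
               \sum_(i < n) (x i - y i) = b /\ pairwise_monochromatic c x y) ->
          (exists2 m : int, 0 < m &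
             exists j : 'I_(2 * n), forall k : int, c (b *~ (k * m)) = j) ->
          PA_degree (coloring_oracle c)].
Proof.
exists weight_group, (generator 0).
split; [exact: weight_group_computable | exact: generator_neq0 |].
move=> c nsol [m m0 [j0 Hj0]] T [treeT [chi chi_comp HT]] infT.
(* The multiple with [k = 0] identifies the common color as that of 0. *)
have Hm j : c (generator 0 *+ (j * `|m|)) = c 0.
  have -> : c 0 = j0 by rewrite -(Hj0 0) mul0r mulr0z.
  by rewrite -(Hj0 j) pmulrn PoszM gtz0_abs.
have chiP s : chi (string_code s) -> T s.
  by move=> /HT[t Tt /string_code_inj <-].
have chi_parent : parent_closed chi.
  move=> S b /HT[t Tt]; case/lastP: t Tt => // t b' Tt; rewrite string_code_rcons.
  case/child_inj => <- _; apply/HT; exists t => //.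
  by apply: treeT Tt; exact: prefix_rcons.
have [e He] := survivor_prog chi_comp.
(* The initial state running [e] on [S] padded with [|m|]. Pairing dominates its components, so this
   state is at least [|m|]. *)
pose query S := <|<|S, `|m|%N|>, push (prog_code e) 0|>%N.
pose d S := c (generator (query S)) != c 0.
pose S := fun i => iter i (fun S => child S (d S)) 0%N.
have HS i l : extends chi (S i) l.
  elim: i l => [|i IHi] /= l.
    (* The root has code 0, so its descendants at level [l] have shifted codes starting at [2 ^ l],
       in the form given by [string_codeS]. *)
    have [t Tt <-] := infinite_tree_size l treeT infT.
    have [j Hj E] := string_codeS t; apply/extendsP; exists j => //.
    by rewrite muln1 -E; apply/HT; exists t.
  apply: (extends_decided chi_parent (d := d)) => // {}l neq Hmin.
  apply: (halting_color hn nsol Hm).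
    rewrite absz_gt0 gt_eqF //=.
    have le_m : (`|m| <= <|S i, `|m|%N|>)%N by exact: leq_trans (leq_addr _ _) (pair_ge _ _).
    exact: leq_trans le_m (leq_trans (leq_addl _ _) (pair_ge _ _)).
  by apply: eval_reaches; exact: He.
have SE i : string_code (mkseq (fun i => d (S i)) i) = S i.
  by elim: i => // i IHi; rewrite mkseqS string_code_rcons IHi.
exists (fun i => d (S i)) => [i|]; first by apply: chiP; rewrite SE -extends0.
(* Each bit takes one oracle query, at the least code of a generator. Both [|m|] and the color of 0
   are fixed numbers, available as constants. *)
have d_comp f : computable_in (coloring_oracle c) f ->
    computable_in (coloring_oracle c) (fun x => nat_of_bool (d (f x))).
  move=> Hf; apply: computable_ext (_ : computable_in _ (fun x => nat_of_bool
    (~~ (coloring_oracle c (least_code (generator_code (query (f x)))) == c 0 :> nat)))).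
    by move=> x; rewrite coloring_oracle_least_code.
  apply/computable_neg/computable_eqn; last exact: computable_const.
  apply/computable_oracle/computable_least_code.
  by rewrite /generator_code /query; computability.
apply: (d_comp); apply: (computable_iter (s := fun _ S => child S (d S))); computability.
by rewrite /child; apply/computable_succ/computable_add; [|apply: (d_comp)]; computability.
Qed.
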